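(* Let $X\in\mathcal C^\infty(M,TM)$ be a Killing vector field on the almost-Hermitian manifold $(M,J,g)$. Then $$ (D^g)^k(\mathcal L_XJ)= X\lrcorner\,(D^g)^{k+1}J + A_X\cdot\big((D^g)^kJ\big)\qquad\text{for any } k\in\mathbb Z_{\geq 0}, $$ where the action of $A_X$ on the tensor algebra is by derivation.
   Context: An almost-Hermitian manifold $(M,J,g)$ is a smooth manifold with an almost-complex structure $J$ and a Riemannian metric $g$ with $g(J\cdot,J\cdot\cdot)=g(\cdot,\cdot\cdot)$. $D^g$ is the Levi-Civita connection of $g$, and $\mathcal L_X$ is the Lie derivative. A vector field $X$ is Killing if $\mathcal L_Xg=0$. For any vector field $X$, $A_X:=-D^gX$ is the endomorphism field $Y\mapsto -D^g_YX$. The iterated covariant derivative $(D^g)^kJ$ is a section of $\bigotimes^kT^*M\otimes\mathrm{End}(TM)$, defined by $\big((D^g)^{k+1}J\big)(Y_0,Y_1,\dots,Y_k)=\big(D^g_{Y_0}((D^g)^kJ)\big)(Y_1,\dots,Y_k)$ (and similarly for $\mathcal L_XJ$ in place of $J$); the contraction $X\lrcorner\,(D^g)^{k+1}J$ inserts $X$ in the first slot, i.e. $(X\lrcorner\,(D^g)^{k+1}J)(Y_1,\dots,Y_k)=\big((D^g)^{k+1}J\big)(X,Y_1,\dots,Y_k)$. An endomorphism $A$ acts on tensors by derivation; e.g. for $Q$ a section of $\bigotimes^kT^*M\otimes\mathrm{End}(TM)$, $(A\cdot Q)(Y_1,\dots,Y_k)=[A,Q(Y_1,\dots,Y_k)]-\sum_iQ(Y_1,\dots,AY_i,\dots,Y_k)$.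 *)

(* Defs.v *)
From HB Require Import structures.
From mathcomp Require Import all_boot all_order all_algebra.
From mathcomp Require Import all_classical all_reals all_analysis.
From mathcomp Require Import ring.

Set Implicit Arguments.
Unset Strict Implicit.
Unset Printing Implicit Defensive.

Import Order.TTheory GRing.Theory Num.Theory.
Import numFieldNormedType.Exports.

Local Open Scope classical_set_scope.
Local Open Scope ring_scope.

Section Smooth.
Context {R : realType} {V W : normedModType R}.

(** Only meant for open [U].  Class C^k is tested with iterated directional
    derivatives, which is the usual notion when [V] is finite-dimensional. *)
Fixpoint Ck (k : nat) (U : set V) (f : V -> W) : Prop :=
  (forall x, U x -> {for x, continuous f}) /\
  if k is k'.+1 then
    forall v : V, (forall x, U x -> derivable f x v) /\ Ck k' U ('D_v f)
  else True.

Definition smooth_on (U : set V) (f : V -> W) : Prop := forall k, Ck k U f.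

Lemma Ck_ext k U (f g : V -> W) :
  open U -> (forall x, U x -> f x = g x) -> Ck k U f -> Ck k U g.
Proof.
move=> oU; elim: k f g => [|k IH] f g fg /= [cf df].
  split=> // x Ux; have nfg : \near x, f x = g x.
    by apply: filterS (open_nbhs_nbhs (conj oU Ux)) => y; exact: fg.
  rewrite /prop_for /continuous_at -(fg _ Ux).
  by apply: cvg_trans (cf x Ux); exact: near_eq_cvg.
have nfg x : U x -> \near x, f x = g x.
  by move=> Ux; apply: filterS (open_nbhs_nbhs (conj oU Ux)) => y; exact: fg.
split=> [x Ux|v].
  rewrite /prop_for /continuous_at -(fg _ Ux).
  by apply: cvg_trans (cf x Ux); exact: near_eq_cvg (nfg x Ux).
have [dfv Cfv] := df v; split=> [x Ux|].
  exact: near_eq_derivable (nfg x Ux) (dfv x Ux).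
apply: IH Cfv => x Ux; exact: near_eq_derive (nfg x Ux).
Qed.

Lemma Ck_weaken k U (f : V -> W) : Ck k.+1 U f -> Ck k U f.
Proof.
elim: k f => [|k IH] f [cf df]; first by split.
by split=> // v; have [? ?] := df v; split=> //; exact: IH.
Qed.

Lemma Ck_cst k U (a : W) : Ck k U (cst a).
Proof.
elim: k a => [|k IH] a; first by split=> // x _; exact: cvg_cst.
split=> [x _|v]; first exact: cvg_cst.
split=> [x _|]; first exact: derivable_cst.
rewrite (_ : 'D_v (cst a) = cst 0) //.
by apply/funext => x; rewrite derive_cst.
Qed.

Lemma CkD k U (f g : V -> W) :
  open U -> Ck k U f -> Ck k U g -> Ck k U (f + g).
Proof.
move=> oU; elim: k f g => [|k IH] f g [cf df] [cg dg].
  by split=> // x Ux; apply: cvgD; [exact: cf|exact: cg].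
split=> [x Ux|v]; first by apply: cvgD; [exact: cf|exact: cg].
have [dfv Cf] := df v; have [dgv Cg] := dg v; split=> [x Ux|].
  by apply: derivableD; [exact: dfv|exact: dgv].
apply: Ck_ext (IH _ _ Cf Cg) => // x Ux.
by rewrite deriveD//; [exact: dfv|exact: dgv].
Qed.

End Smooth.

Lemma CkM {R : realType} {V : normedModType R} k U (f g : V -> R) :
  open U -> Ck k U f -> Ck k U g -> Ck k U (f * g).
Proof.
move=> oU; elim: k f g => [|k IH] f g Hf Hg; have [cf df] := Hf;
  have [cg dg] := Hg.
  by split=> // x Ux; apply: cvgM; [exact: cf|exact: cg].
split=> [x Ux|v]; first by apply: cvgM; [exact: cf|exact: cg].
have [dfv Cf] := df v; have [dgv Cg] := dg v; split=> [x Ux|].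
  by apply: derivableM; [exact: dfv|exact: dgv].
apply: (@Ck_ext _ _ _ _ _ (f * 'D_v g + g * 'D_v f)) => //.
  by move=> x Ux; rewrite deriveM//; [exact: dfv|exact: dgv].
by apply: CkD => //; apply: IH => //; exact: Ck_weaken.
Qed.

(** [chart_map] and [chart_inv] are total functions whose values outside
    [chart_dom] and [chart_map @` chart_dom] are irrelevant. *)
Record chart (R : realType) (n : nat) (M : topologicalType) := Chart {
  chart_dom : set M;
  chart_map : M -> 'rV[R]_n;
  chart_inv : 'rV[R]_n -> M;
  chart_dom_open : open chart_dom;
  chart_cod_open : open (chart_map @` chart_dom);
  chart_mapK : forall p, chart_dom p -> chart_inv (chart_map p) = p;
  chart_map_continuous : forall p, chart_dom p -> {for p, continuous chart_map};
  chart_inv_continuous : forall x, (chart_map @` chart_dom) x ->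
    {for x, continuous chart_inv} }.

Definition chart_cod (R : realType) (n : nat) (M : topologicalType)
  (c : chart R n M) : set 'rV[R]_n := chart_map c @` chart_dom c.

Record manifold (R : realType) (n : nat) := Manifold {
  carrier :> topologicalType;
  atlas : set (chart R n carrier);
  manifold_hausdorff : hausdorff_space carrier;
  manifold_second_countable : @second_countable carrier;
  atlas_cover : forall p : carrier, exists2 c, atlas c & chart_dom c p;
  atlas_compatible : forall c d, atlas c -> atlas d ->
    smooth_on (chart_map c @` (chart_dom c `&` chart_dom d))
      (chart_map d \o chart_inv c) }.

Section SmoothFunctions.
Context {R : realType} {n : nat} (M : manifold R n).

Definition is_smooth (f : M -> R) : Prop :=
  forall c, atlas c -> smooth_on (chart_cod c) (f \o chart_inv c).

Definition smooth : {pred M -> R} := [pred f | `[< is_smooth f >]].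

Lemma is_smooth_cst a : is_smooth (cst a).
Proof. by move=> c _ k; exact: (Ck_cst k _ a). Qed.

Lemma is_smoothD f g : is_smooth f -> is_smooth g -> is_smooth (f + g).
Proof.
move=> sf sg c ac k.
apply: (@CkD _ _ _ _ _ (f \o chart_inv c) (g \o chart_inv c)).
- exact: chart_cod_open.
- exact: sf.
- exact: sg.
Qed.

Lemma is_smoothM f g : is_smooth f -> is_smooth g -> is_smooth (f * g).
Proof.
move=> sf sg c ac k.
apply: (@CkM _ _ _ _ (f \o chart_inv c) (g \o chart_inv c)).
- exact: chart_cod_open.
- exact: sf.
- exact: sg.
Qed.

Lemma is_smoothZ a f : is_smooth f -> is_smooth (a *: f).
Proof. by move=> sf; apply: (@is_smoothM (cst a)) => //; exact: is_smooth_cst. Qed.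

Lemma is_smoothB f g : is_smooth f -> is_smooth g -> is_smooth (f - g).
Proof.
move=> sf sg; apply: is_smoothD => //.
by rewrite -scaleN1r; exact: is_smoothZ.
Qed.

Lemma smooth_subring_closed : subring_closed smooth.
Proof.
split=> [|f g /asboolP sf /asboolP sg|f g /asboolP sf /asboolP sg];
  apply/asboolP; [exact: is_smooth_cst|exact: is_smoothB|exact: is_smoothM].
Qed.
HB.instance Definition _ :=
  GRing.isSubringClosed.Build (M -> R) smooth smooth_subring_closed.

Lemma smooth_scaler_closed : scaler_closed smooth.
Proof. by move=> a f /asboolP sf; apply/asboolP; exact: is_smoothZ. Qed.
HB.instance Definition _ :=
  GRing.isScaleClosed.Build R (M -> R) smooth smooth_scaler_closed.

Record smoothfun := SmoothFun {
  smoothfun_val :> M -> R;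
  smoothfunP : smoothfun_val \in smooth }.

HB.instance Definition _ := [isSub for smoothfun_val].
HB.instance Definition _ := [Choice of smoothfun by <:].
HB.instance Definition _ := GRing.SubChoice_isSubComPzRing.Build (M -> R) (smooth) smoothfun (subringClosedP _).
HB.instance Definition _ := [SubZmodule_isSubLmodule of smoothfun by <:].

End SmoothFunctions.

Arguments is_smooth {R n M}.

Section SmoothFunctionsTheory.
Context {R : realType} {n : nat} {M : manifold R n}.
Implicit Types f g : smoothfun M.

Lemma smoothfun_eq f g : f =1 g -> f = g.
Proof. by move=> fg; apply: val_inj; exact/funext. Qed.

Lemma smoothfunW f : is_smooth f.
Proof. exact/asboolP/(smoothfunP f). Qed.

Definition mk_smoothfun (f : M -> R) (sf : is_smooth f) : smoothfun M :=
  SmoothFun (asboolT sf).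

End SmoothFunctionsTheory.

Section Tangent.
Context {R : realType} {n : nat} (M : manifold R n) (p : M).

Definition is_derivation_at (v : smoothfun M -> R^o) : Prop :=
  (forall (a : R) f g, v (a *: f + g) = a * v f + v g) /\
  (forall f g, v (f * g) = f p * v g + g p * v f).

Definition derivation_at : {pred smoothfun M -> R^o} :=
  [pred v | `[< is_derivation_at v >]].

Lemma derivation_at_submod_closed : submod_closed derivation_at.
Proof.
split=> [|a v w /asboolP[lv dv] /asboolP[lw dw]]; apply/asboolP.
  by split=> *; rewrite !mulr0 addr0.
split=> [b f g|f g].
  rewrite /= !fctE lv lw !scalerDr /GRing.scale/= mulrDr !mulrA (mulrC a b).
  by rewrite addrACA.
rewrite /= !fctE dv dw scalerDr /GRing.scale/= !mulrDr !mulrA.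
by rewrite (mulrC a (f p)) (mulrC a (g p)) addrACA.
Qed.
HB.instance Definition _ := GRing.isSubmodClosed.Build R (smoothfun M -> R^o)
  derivation_at derivation_at_submod_closed.

(** The tangent space at [p]: derivations of C^oo(M) at [p]. *)
Record tangent := Tangent {
  tangent_val :> smoothfun M -> R^o;
  tangentP : tangent_val \in derivation_at }.

HB.instance Definition _ := [isSub for tangent_val].
HB.instance Definition _ := [Choice of tangent by <:].
HB.instance Definition _ := [SubChoice_isSubLmodule of tangent by <:].

End Tangent.

Section TangentTheory.
Context {R : realType} {n : nat} {M : manifold R n} {p : M}.
Implicit Types (v w : tangent p) (f g : smoothfun M).

Lemma tangent_eq v w : v =1 w -> v = w.
Proof. by move=> vw; apply: val_inj; exact/funext. Qed.

Lemma tangent_lin v a f g : v (a *: f + g) = a * v f + v g.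
Proof. by have /asboolP[+ _] := tangentP v; exact. Qed.

Lemma tangentM v f g : v (f * g) = f p * v g + g p * v f.
Proof. by have /asboolP[_ +] := tangentP v; exact. Qed.

Lemma tangentDf v f g : v (f + g) = v f + v g.
Proof. by rewrite -[f in LHS]scale1r tangent_lin mul1r. Qed.

Lemma tangentBf v f g : v (f - g) = v f - v g.
Proof. by rewrite addrC -scaleN1r tangent_lin mulN1r addrC. Qed.

Lemma tangentZf v a f : v (a *: f) = a * v f.
Proof.
have v0 : v 0 = 0 by rewrite -(subrr (0 : smoothfun M)) tangentBf subrr.
by rewrite -[a *: f]addr0 tangent_lin v0 addr0.
Qed.

End TangentTheory.

Section VectorFields.
Context {R : realType} {n : nat} (M : manifold R n).

Definition smooth_section (s : forall p : M, tangent p) : Prop :=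
  forall f : smoothfun M, is_smooth (fun p => s p f).

Record vfield := VField {
  vfield_val :> forall p : M, tangent p;
  vfieldP : smooth_section vfield_val }.

End VectorFields.

Section VectorFieldsTheory.
Context {R : realType} {n : nat} {M : manifold R n}.
Local Notation C := (smoothfun M).
Local Notation V := (vfield M).
Implicit Types (f g h : C) (X Y Z : V) (p : M).

HB.instance Definition _ := gen_eqMixin V.
HB.instance Definition _ := gen_choiceMixin V.

Lemma vfield_eq X Y : (forall p, X p = Y p) -> X = Y.
Proof.
case: X Y => [X sX] [Y sY] /= XY; have {}XY : X = Y by exact: functional_extensionality_dep.
by subst; congr VField; exact: Prop_irrelevance.
Qed.

(** [vapp X f] is the function X.f = df(X). *)
Definition vapp X f : C := mk_smoothfun (vfieldP X f).

Lemma vapp_eq X Y : (forall f, vapp X f = vapp Y f) -> X = Y.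
Proof.
move=> XY; apply: vfield_eq => p; apply: tangent_eq => f.
exact: (congr1 (fun h : C => h p) (XY f)).
Qed.

Lemma vzero_smooth : smooth_section (fun p : M => 0 : tangent p).
Proof. by move=> f; exact: is_smooth_cst. Qed.

Lemma vopp_smooth X : smooth_section (fun p => - X p).
Proof. by move=> f; exact: smoothfunW (- vapp X f). Qed.

Lemma vadd_smooth X Y : smooth_section (fun p => X p + Y p).
Proof. by move=> f; exact: smoothfunW (vapp X f + vapp Y f). Qed.

Lemma vscale_smooth h X : smooth_section (fun p => h p *: X p).
Proof. by move=> f; exact: smoothfunW (h * vapp X f). Qed.

Definition vzero : V := VField vzero_smooth.
Definition vopp X : V := VField (vopp_smooth X).
Definition vadd X Y : V := VField (vadd_smooth X Y).
Definition vscale h X : V := VField (vscale_smooth h X).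

Fact vaddA : associative vadd.
Proof. by move=> X Y Z; apply: vfield_eq => p /=; rewrite addrA. Qed.
Fact vaddC : commutative vadd.
Proof. by move=> X Y; apply: vfield_eq => p /=; rewrite addrC. Qed.
Fact vadd0 : left_id vzero vadd.
Proof. by move=> X; apply: vfield_eq => p /=; rewrite add0r. Qed.
Fact vaddN : left_inverse vzero vopp vadd.
Proof. by move=> X; apply: vfield_eq => p /=; rewrite addNr. Qed.
HB.instance Definition _ := GRing.isZmodule.Build V vaddA vaddC vadd0 vaddN.

Fact vscaleA f g X : vscale f (vscale g X) = vscale (f * g) X.
Proof. by apply: vfield_eq => p /=; rewrite scalerA. Qed.
Fact vscale1 : left_id 1 vscale.
Proof. by move=> X; apply: vfield_eq => p /=; rewrite scale1r. Qed.
Fact vscaleDr : right_distributive vscale +%R.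
Proof. by move=> f X Y; apply: vfield_eq => p /=; rewrite scalerDr. Qed.
Fact vscaleDl X : {morph vscale^~ X : f g / f + g}.
Proof. by move=> f g; apply: vfield_eq => p /=; rewrite scalerDl. Qed.
HB.instance Definition _ := GRing.Zmodule_isLmodule.Build C V
  vscaleA vscale1 vscaleDr vscaleDl.

Lemma vappD X Y f : vapp (X + Y) f = vapp X f + vapp Y f.
Proof. exact: smoothfun_eq. Qed.
Lemma vappN X f : vapp (- X) f = - vapp X f.
Proof. exact: smoothfun_eq. Qed.
Lemma vappB X Y f : vapp (X - Y) f = vapp X f - vapp Y f.
Proof. exact: smoothfun_eq. Qed.
Lemma vappZ h X f : vapp (h *: X) f = h * vapp X f.
Proof. exact: smoothfun_eq. Qed.
Lemma vapp_fD X f g : vapp X (f + g) = vapp X f + vapp X g.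
Proof. by apply: smoothfun_eq => p; exact: tangentDf. Qed.
Lemma vapp_fB X f g : vapp X (f - g) = vapp X f - vapp X g.
Proof. by apply: smoothfun_eq => p; exact: tangentBf. Qed.
Lemma vapp_fZ X a f : vapp X (a *: f) = a *: vapp X f.
Proof. by apply: smoothfun_eq => p; exact: tangentZf. Qed.
Lemma vapp_fM X f g : vapp X (f * g) = f * vapp X g + g * vapp X f.
Proof. by apply: smoothfun_eq => p; exact: tangentM. Qed.

Fact bracket_derivation X Y p :
  (fun f => X p (vapp Y f) - Y p (vapp X f) : R^o) \in derivation_at p.
Proof.
apply/asboolP; split=> [a f g|f g].
  rewrite !vapp_fD !vapp_fZ !tangent_lin mulrBr opprD addrACA.
  by congr (_ + _).
rewrite !vapp_fM !tangentDf !tangentM /= !mulrBr.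
by ring.
Qed.


Lemma bracket_smooth X Y :
  smooth_section (fun p => Tangent (bracket_derivation X Y p)).
Proof. by move=> f; exact: smoothfunW (vapp X (vapp Y f) - vapp Y (vapp X f)). Qed.

Definition bracket X Y : V := VField (bracket_smooth X Y).

Lemma vapp_bracket X Y f :
  vapp (bracket X Y) f = vapp X (vapp Y f) - vapp Y (vapp X f).
Proof. exact: smoothfun_eq. Qed.

(** [d] is an R-linear derivation of the C^oo(M)-module of vector fields,
    covering the derivation [W] of C^oo(M). *)
Record derivation_over (W : V) (d : V -> V) : Prop := DerivationOver {
  derivation_overD : forall Y Z, d (Y + Z) = d Y + d Z;
  derivation_overZ : forall f Y, d (f *: Y) = vapp W f *: Y + f *: d Y }.

Lemma bracket_derivation_over X : derivation_over X (bracket X).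
Proof.
split=> [Y Z|f Y]; apply: vapp_eq => g.
  by rewrite !(vappD, vapp_bracket) vapp_fD opprD addrACA.
rewrite !(vappD, vappZ, vapp_bracket) vapp_fM.
by ring.
Qed.

Lemma endo_derivation_over (A : {linear V -> V}) : derivation_over 0 A.
Proof.
split=> [Y Z|f Y]; first by rewrite linearD.
rewrite linearZ /= (_ : vapp 0 f = 0) ?scale0r ?add0r //.
exact: smoothfun_eq.
Qed.

End VectorFieldsTheory.

Section Tensors.
Context {R : realType} {n : nat} {M : manifold R n}.
Local Notation C := (smoothfun M).
Local Notation V := (vfield M).

Definition upd (k : nat) (Ys : 'I_k -> V) (i : 'I_k) (Y : V) : 'I_k -> V :=
  fun j => if j == i then Y else Ys j.

Definition vcons (k : nat) (Y : V) (Ys : 'I_k -> V) : 'I_k.+1 -> V :=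
  fun i => if unlift ord0 i is Some j then Ys j else Y.

Definition vtail (k : nat) (Ys : 'I_k.+1 -> V) : 'I_k -> V :=
  fun i => Ys (lift ord0 i).

(** Sections of (T*M)^{(x) k} (x) End(TM), as maps that are C^oo(M)-linear in
    each of the k vector fields [Ys] and in the last argument [Z]:
    [Q Ys] is the endomorphism field Q(Y_1, ..., Y_k). *)
Definition is_tensor (k : nat) (Q : ('I_k -> V) -> V -> V) : Prop :=
  (forall Ys (i : 'I_k) (f : C) (Y Y' Z : V),
     Q (upd Ys i (f *: Y + Y')) Z = f *: Q (upd Ys i Y) Z + Q (upd Ys i Y') Z) /\
  (forall Ys (f : C) (Z Z' : V), Q Ys (f *: Z + Z') = f *: Q Ys Z + Q Ys Z').

Definition tensorial (k : nat) : {pred ('I_k -> V) -> V -> V} :=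
  [pred Q | `[< is_tensor Q >]].

Lemma tensorial_zmod_closed k : zmod_closed (@tensorial k).
Proof.
split=> [|P Q /asboolP[sP eP] /asboolP[sQ eQ]]; apply/asboolP.
  by split=> *; rewrite /= scaler0 addr0.
split=> [Ys i f Y Y' Z|Ys f Z Z'].
  by rewrite /= !fctE sP sQ scalerBr opprD addrACA.
by rewrite /= !fctE eP eQ scalerBr opprD addrACA.
Qed.
HB.instance Definition _ k := GRing.isZmodClosed.Build
  (('I_k -> V) -> V -> V) (@tensorial k) (@tensorial_zmod_closed k).

Record tensor (k : nat) := Tensor {
  tensor_val :> ('I_k -> V) -> V -> V;
  tensorP : tensor_val \in @tensorial k }.

HB.instance Definition _ k := [isSub for @tensor_val k].
HB.instance Definition _ k := [Choice of tensor k by <:].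
HB.instance Definition _ k := [SubChoice_isSubZmodule of tensor k by <:].

Lemma tensor_eq k (P Q : tensor k) : (forall Ys Z, P Ys Z = Q Ys Z) -> P = Q.
Proof. by move=> PQ; apply: val_inj; apply/funext => Ys; apply/funext => Z; exact: PQ. Qed.

Lemma tensor_slot k (Q : tensor k) Ys i f Y Y' Z :
  Q (upd Ys i (f *: Y + Y')) Z = f *: Q (upd Ys i Y) Z + Q (upd Ys i Y') Z.
Proof. by have /asboolP[+ _] := tensorP Q; exact. Qed.

Lemma tensor_endo k (Q : tensor k) Ys f Z Z' :
  Q Ys (f *: Z + Z') = f *: Q Ys Z + Q Ys Z'.
Proof. by have /asboolP[_ +] := tensorP Q; exact. Qed.

Lemma upd_same k (Ys : 'I_k -> V) i Y : upd Ys i Y i = Y.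
Proof. by rewrite /upd eqxx. Qed.

Lemma upd_other k (Ys : 'I_k -> V) i j Y : j != i -> upd Ys i Y j = Ys j.
Proof. by rewrite /upd => /negbTE ->. Qed.

Lemma upd_upd k (Ys : 'I_k -> V) i Y Y' : upd (upd Ys i Y) i Y' = upd Ys i Y'.
Proof. by apply/funext => j; rewrite /upd; case: eqP. Qed.

Lemma updC k (Ys : 'I_k -> V) i j Y Y' : i != j ->
  upd (upd Ys i Y) j Y' = upd (upd Ys j Y') i Y.
Proof.
move=> ij; apply/funext => l; rewrite /upd; case: eqP => // ->.
by rewrite eq_sym (negbTE ij).
Qed.

Lemma vtail_upd0 k (Ys : 'I_k.+1 -> V) Y : vtail (upd Ys ord0 Y) = vtail Ys.
Proof. by apply/funext => i; rewrite /vtail upd_other. Qed.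

Lemma vtail_upd k (Ys : 'I_k.+1 -> V) i Y :
  vtail (upd Ys (lift ord0 i) Y) = upd (vtail Ys) i Y.
Proof.
by apply/funext => j; rewrite /vtail /upd (inj_eq (@lift_inj _ ord0)).
Qed.

Lemma vcons_upd k (Ys : 'I_k -> V) i X Y :
  vcons X (upd Ys i Y) = upd (vcons X Ys) (lift ord0 i) Y.
Proof.
apply/funext => j; rewrite /vcons /upd; case: unliftP => [l ->|->].
  by rewrite (inj_eq (@lift_inj _ ord0)).
by rewrite (negbTE (neq_lift _ _)).
Qed.

Fact endo_tensor_is_tensor (S : {linear V -> V}) :
  (fun (_ : 'I_0 -> V) Z => S Z) \in @tensorial 0.
Proof.
by apply/asboolP; split=> [Ys []//|Ys f Z Z']; rewrite linearP.
Qed.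

Definition endo_tensor (S : {linear V -> V}) : tensor 0 :=
  Tensor (endo_tensor_is_tensor S).

(** The extension of [d] to tensors by the Leibniz rule. *)
Definition deriv_ext_fun (d : V -> V) (k : nat) (Q : ('I_k -> V) -> V -> V)
    (Ys : 'I_k -> V) (Z : V) : V :=
  d (Q Ys Z) - Q Ys (d Z) - \sum_(i < k) Q (upd Ys i (d (Ys i))) Z.

Fact deriv_ext_is_tensor W d (hd : derivation_over W d) k (Q : tensor k) :
  deriv_ext_fun d Q \in @tensorial k.
Proof.
have dE f a b : d (f *: a + b) = vapp W f *: a + (f *: d a + d b).
  by rewrite (derivation_overD hd) (derivation_overZ hd) addrA.
have slotE (f : C) (wq dq dq' q q' dz dz' s s' : V) :
    wq + (f *: dq + dq') - (f *: dz + dz') - (wq + (f *: q + q') + (f *: s + s'))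
    = f *: (dq - dz - (q + s)) + (dq' - dz' - (q' + s')).
  by apply: vapp_eq => g; rewrite !(vappD, vappN, vappZ); ring.
have endoE (f : C) (wq dq dq' dz dz' s s' : V) :
    wq + (f *: dq + dq') - (wq + (f *: dz + dz')) - (f *: s + s')
    = f *: (dq - dz - s) + (dq' - dz' - s').
  by apply: vapp_eq => g; rewrite !(vappD, vappN, vappZ); ring.
apply/asboolP; split=> [Ys i f Y Y' Z|Ys f Z Z']; rewrite /deriv_ext_fun.
  have sumE T : \sum_(j < k) Q (upd (upd Ys i T) j (d (upd Ys i T j))) Z =
      Q (upd Ys i (d T)) Z +
      \sum_(j < k | j != i) Q (upd (upd Ys j (d (Ys j))) i T) Z.
    rewrite (bigD1 i) //= upd_same upd_upd; congr (_ + _).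
    apply: eq_bigr => j ji; rewrite upd_other // updC //.
    by rewrite eq_sym.
  rewrite !sumE (eq_bigr _ (fun j _ => tensor_slot Q _ i f Y Y' Z)).
  rewrite big_split /= -scaler_sumr.
  rewrite (tensor_slot Q Ys i f Y Y' Z) (tensor_slot Q Ys i f Y Y' (d Z)) !dE.
  rewrite (tensor_slot Q Ys i (vapp W f) Y).
  by rewrite (tensor_slot Q Ys i f (d Y) (d Y') Z) slotE.
rewrite (eq_bigr _ (fun i _ => tensor_endo Q _ f Z Z')).
rewrite big_split /= -scaler_sumr (tensor_endo Q Ys f Z Z') !dE.
rewrite (tensor_endo Q Ys (vapp W f) Z) (tensor_endo Q Ys f (d Z)).
by rewrite endoE.
Qed.

Definition deriv_ext W d (hd : derivation_over W d) k (Q : tensor k) : tensor k :=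
  Tensor (deriv_ext_is_tensor hd Q).

Fact interior_prod_is_tensor X k (Q : tensor k.+1) :
  (fun Ys Z => Q (vcons X Ys) Z) \in @tensorial k.
Proof.
apply/asboolP; split=> [Ys i f Y Y' Z|Ys f Z Z']; last exact: tensor_endo.
by rewrite !vcons_upd; exact: tensor_slot.
Qed.

Definition interior_prod X k (Q : tensor k.+1) : tensor k :=
  Tensor (interior_prod_is_tensor X Q).

(** An endomorphism field acts by derivation, trivially on functions. *)
Definition endo_act (A : {linear V -> V}) k (Q : tensor k) : tensor k :=
  deriv_ext (endo_derivation_over A) Q.

(** L_X is the tensor derivation with L_X f = X.f and L_X Y = [X, Y]. *)
Definition lie_deriv X k (Q : tensor k) : tensor k :=
  deriv_ext (bracket_derivation_over X) Q.

End Tensors.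

Section Connections.
Context {R : realType} {n : nat} (M : manifold R n).
Local Notation V := (vfield M).

Record connection := Connection {
  conn :> V -> V -> V;
  conn_lin : forall Y, linear (conn ^~ Y);
  conn_leibniz : forall Y, derivation_over Y (conn Y) }.

End Connections.

Section CovariantDerivative.
Context {R : realType} {n : nat} {M : manifold R n}.
Local Notation C := (smoothfun M).
Local Notation V := (vfield M).
Implicit Types (D : connection M) (X Y Z : V).

Definition cov_deriv D Y k (Q : tensor k) : tensor k :=
  deriv_ext (conn_leibniz D Y) Q.

(** The new differentiation slot comes first:
    (nabla Q)(Y_0, ..., Y_k) = (D_{Y_0} Q)(Y_1, ..., Y_k). *)
Fact nabla_is_tensor D k (Q : tensor k) :
  (fun Ys Z => cov_deriv D (Ys ord0) Q (vtail Ys) Z) \in @tensorial R n M k.+1.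
Proof.
apply/asboolP; split=> [Ys i f Y Y' Z|Ys f Z Z']; last exact: tensor_endo.
case: (unliftP ord0 i) => [j ->|->].
  rewrite !upd_other // !vtail_upd; exact: tensor_slot.
rewrite !upd_same !vtail_upd0 /= /deriv_ext_fun.
have mE (a b c a' b' c' : V) : f *: a + a' - (f *: b + b') - (f *: c + c') =
    f *: (a - b - c) + (a' - b' - c').
  by apply: vapp_eq => g; rewrite !(vappD, vappN, vappZ); ring.
have DE T : D (f *: Y + Y') T = f *: D Y T + D Y' T by exact: conn_lin.
rewrite !DE (tensor_endo Q) -mE; congr (_ - _).
rewrite scaler_sumr -big_split /=; apply: eq_bigr => j _.
by rewrite DE (tensor_slot Q).
Qed.

Definition nabla D k (Q : tensor k) : tensor k.+1 :=
  Tensor (nabla_is_tensor D Q).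

Fixpoint iter_nabla D (S : @tensor R n M 0) (k : nat) : tensor k :=
  if k is k'.+1 then nabla D (iter_nabla D S k') else S.

(** The endomorphism field A_X : Y |-> - D_Y X. *)
Definition endoA D X (Y : V) : V := - D Y X.

Fact endoA_linear D X : linear (endoA D X).
Proof. by move=> f Y Y'; rewrite /endoA conn_lin opprD scalerN. Qed.
HB.instance Definition _ D X :=
  GRing.isLinear.Build C V V _ (endoA D X) (endoA_linear D X).

End CovariantDerivative.

Section AlmostHermitian.
Context {R : realType} {n : nat} (M : manifold R n).

Record riemannian_metric := RiemannianMetric {
  metric :> forall p : M, tangent p -> tangent p -> R;
  metric_lin : forall (p : M) (w : tangent p),
    linear ((@metric p ^~ w) : tangent p -> R^o);
  metric_sym : forall (p : M) (v w : tangent p), @metric p v w = @metric p w v;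
  metric_gt0 : forall (p : M) (v : tangent p), v != 0 -> 0 < @metric p v v;
  metric_smooth : forall Y Z : vfield M, is_smooth (fun p => @metric p (Y p) (Z p)) }.

Record almost_complex := AlmostComplex {
  acs :> forall p : M, {linear tangent p -> tangent p};
  acs_sqr : forall (p : M) (v : tangent p), acs p (acs p v) = - v;
  acs_smooth : forall Y : vfield M, smooth_section (fun p => acs p (Y p)) }.

Definition almost_hermitian (J : almost_complex) (g : riemannian_metric) : Prop :=
  forall (p : M) (v w : tangent p), g p (J p v) (J p w) = g p v w.

End AlmostHermitian.

Section AlmostHermitianTheory.
Context {R : realType} {n : nat} {M : manifold R n}.
Local Notation C := (smoothfun M).
Local Notation V := (vfield M).
Implicit Types (g : riemannian_metric M) (J : almost_complex M) (X Y Z : V).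

Definition mapp g Y Z : C := mk_smoothfun (metric_smooth g Y Z).

Definition acs_field J Y : V := VField (acs_smooth J Y).

Fact acs_field_linear J : linear (acs_field J).
Proof.
by move=> f Y Z; apply: vfield_eq => p; rewrite /= linearP.
Qed.
HB.instance Definition _ J :=
  GRing.isLinear.Build C V V _ (acs_field J) (acs_field_linear J).

Definition acs_tensor J : tensor 0 := endo_tensor (acs_field J).

Definition torsion_free (D : connection M) : Prop :=
  forall Y Z, D Y Z - D Z Y = bracket Y Z.

Definition metric_compatible g (D : connection M) : Prop :=
  forall X Y Z, vapp X (mapp g Y Z) = mapp g (D X Y) Z + mapp g Y (D X Z).

Definition levi_civita g (D : connection M) : Prop :=
  torsion_free D /\ metric_compatible g D.

(** The value (L_X g)(Y, Z), for the tensor derivation L_X as in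
    [lie_deriv]. *)
Definition lie_metric X g Y Z : C :=
  vapp X (mapp g Y Z) - mapp g (bracket X Y) Z - mapp g Y (bracket X Z).

Definition killing g X : Prop := forall Y Z, lie_metric X g Y Z = 0.

End AlmostHermitianTheory.

(* Main.v *)
(** Torsion-freeness gives [L_X Y = D_X Y + A_X Y], so the right-hand side of
    the formula is the Lie derivative of the k-th covariant derivative of J, and
    the claim is that L_X commutes with the covariant derivative.  The commutator
    of two tensor derivations is the tensor derivation extending the commutator
    of their actions on vector fields, so it suffices that
    [B(Y, Z) = L_X (D_Y Z) - D_(L_X Y) Z - D_Y (L_X Z)] vanishes.  By the Jacobi
    identity [B] is symmetric; as X is Killing and D is metric,
    [(Y, Z, W) |-> g(B(Y, Z), W)] is antisymmetric in [Z] and [W].  A trilinear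
    form symmetric in one such pair and antisymmetric in the other is zero. *)
Require Import Defs.
From mathcomp Require Import all_boot all_order all_algebra.
From mathcomp Require Import all_classical all_reals all_analysis.
From mathcomp Require Import ring.

Import Order.TTheory GRing.Theory Num.Theory.
Import numFieldNormedType.Exports.

Local Open Scope ring_scope.

(** * Sums and commutators of Leibniz extensions to tensors *)

Section DerivationExtension.
Context {R : realType} {n : nat} {M : manifold R n}.
Local Notation V := (vfield M).

Lemma derivation_over0 {W : V} {d : V -> V} (hd : derivation_over W d) : d 0 = 0.
Proof. by apply: (addrI (d 0)); rewrite -(derivation_overD hd) !addr0. Qed.

Lemma derivation_overN {W : V} {d : V -> V} (hd : derivation_over W d) Y :
  d (- Y) = - d Y.
Proof.
apply: (addrI (d Y)); rewrite -(derivation_overD hd) !subrr.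
exact: derivation_over0 hd.
Qed.

Lemma tensor_slotD {k} (Q : tensor k) (Ys : 'I_k -> V) i Y Y' Z :
  Q (upd Ys i (Y + Y')) Z = Q (upd Ys i Y) Z + Q (upd Ys i Y') Z.
Proof. by rewrite -[Y in LHS]scale1r tensor_slot scale1r. Qed.

Lemma tensor_endoD {k} (Q : tensor k) (Ys : 'I_k -> V) Z Z' :
  Q Ys (Z + Z') = Q Ys Z + Q Ys Z'.
Proof. by rewrite -[Z in LHS]scale1r tensor_endo scale1r. Qed.

Lemma deriv_ext_funD {c d e : V -> V} (cE : forall Y, c Y = d Y + e Y)
    {k} (Q : tensor k) (Ys : 'I_k -> V) Z :
  deriv_ext_fun c Q Ys Z = deriv_ext_fun d Q Ys Z + deriv_ext_fun e Q Ys Z.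
Proof.
have sumE : \sum_(i < k) Q (upd Ys i (c (Ys i))) Z =
    \sum_(i < k) Q (upd Ys i (d (Ys i))) Z
    + \sum_(i < k) Q (upd Ys i (e (Ys i))) Z.
  by rewrite -big_split; apply: eq_bigr => i _; rewrite cE tensor_slotD.
rewrite /deriv_ext_fun sumE !cE tensor_endoD.
by apply: vapp_eq => h; rewrite !(vappD, vappN); ring.
Qed.

(** The expansion is grouped so that only the first three terms, where [d] and [e] are composed,
    change when the two are swapped. The last double sum is symmetric after exchanging [i] and
    [j]. *)
Lemma deriv_ext_fun_comp {W W' : V} {d e : V -> V} (hd : derivation_over W d)
    (he : derivation_over W' e) {k} (Q : tensor k) (Ys : 'I_k -> V) Z :
  deriv_ext_fun d (deriv_ext_fun e Q) Ys Z =
  d (e (Q Ys Z)) + Q Ys (e (d Z)) + \sum_(i < k) Q (upd Ys i (e (d (Ys i)))) Z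
  - (d (Q Ys (e Z)) + e (Q Ys (d Z)))
  - (\sum_(i < k) d (Q (upd Ys i (e (Ys i))) Z)
     + \sum_(i < k) e (Q (upd Ys i (d (Ys i))) Z))
  + (\sum_(i < k) Q (upd Ys i (e (Ys i))) (d Z)
     + \sum_(i < k) Q (upd Ys i (d (Ys i))) (e Z))
  + \sum_(i < k) \sum_(j < k | j != i)
      Q (upd (upd Ys i (d (Ys i))) j (e (Ys j))) Z.
Proof.
(* The slot already changed by [d] is hit again by [e], giving [e (d _)]; the other slots still hold
   their original fields. *)
have diagE i : \sum_(j < k) Q (upd (upd Ys i (d (Ys i))) j
                                 (e (upd Ys i (d (Ys i)) j))) Z =
    Q (upd Ys i (e (d (Ys i)))) Z +
    \sum_(j < k | j != i) Q (upd (upd Ys i (d (Ys i))) j (e (Ys j))) Z.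
  rewrite (bigD1 i) //= upd_same upd_upd; congr (_ + _).
  by apply: eq_bigr => j ji; rewrite upd_other.
rewrite /deriv_ext_fun !(derivation_overD hd, derivation_overN hd).
rewrite (big_morph d (derivation_overD hd) (derivation_over0 hd)).
rewrite !sumrB (eq_bigr _ (fun i _ => diagE i)) big_split /=.
by apply: vapp_eq => h; rewrite !(vappD, vappN); ring.
Qed.

(** Here [c] is the commutator of [d] and [e]. All mixed terms cancel, so only the composites
    contribute, and [Q] is additive in each argument. *)
Lemma deriv_ext_fun_comm {W W' : V} {c d e : V -> V} (hd : derivation_over W d)
    (he : derivation_over W' e) (deE : forall Y, d (e Y) = c Y + e (d Y))
    {k} (Q : tensor k) (Ys : 'I_k -> V) Z :
  deriv_ext_fun d (deriv_ext_fun e Q) Ys Z =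
  deriv_ext_fun c Q Ys Z + deriv_ext_fun e (deriv_ext_fun d Q) Ys Z.
Proof.
(* Updates in distinct slots commute, so this is an exchange of the two summation indices. *)
have offdiagC : \sum_(i < k) \sum_(j < k | j != i)
      Q (upd (upd Ys i (e (Ys i))) j (d (Ys j))) Z =
    \sum_(i < k) \sum_(j < k | j != i)
      Q (upd (upd Ys i (d (Ys i))) j (e (Ys j))) Z.
  rewrite (exchange_big_dep predT) //=; apply: eq_bigr => i _.
  by apply: eq_big => [j|j ij]; [rewrite eq_sym|rewrite updC // eq_sym].
have sumE : \sum_(i < k) Q (upd Ys i (d (e (Ys i)))) Z =
    \sum_(i < k) Q (upd Ys i (c (Ys i))) Z
    + \sum_(i < k) Q (upd Ys i (e (d (Ys i)))) Z.
  by rewrite -big_split; apply: eq_bigr => i _; rewrite deE tensor_slotD.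
rewrite (deriv_ext_fun_comp hd he) (deriv_ext_fun_comp he hd) /deriv_ext_fun.
rewrite offdiagC sumE !deE tensor_endoD.
by apply: vapp_eq => h; rewrite !(vappD, vappN); ring.
Qed.

Lemma vcons0 {k} Y (Ys : 'I_k -> V) : vcons Y Ys ord0 = Y.
Proof. by rewrite /vcons unlift_none. Qed.

Lemma vconsK {k} Y (Ys : 'I_k -> V) : vtail (vcons Y Ys) = Ys.
Proof. by apply/funext => i; rewrite /vtail /vcons liftK. Qed.

End DerivationExtension.

(** * Vanishing of the Lie derivative of the Levi-Civita connection *)

Section LieDerivative.
Context {R : realType} {n : nat} {M : manifold R n}.
Local Notation V := (vfield M).
Implicit Types (g : riemannian_metric M) (D : connection M) (X Y Z W : V).

Lemma bracket_jacobi X Y Z :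
  bracket X (bracket Y Z) = bracket (bracket X Y) Z + bracket Y (bracket X Z).
Proof.
apply: vapp_eq => h; rewrite !(vappD, vapp_bracket) !(vapp_fB, vapp_bracket).
by ring.
Qed.

Lemma mapp_sym g Y Z : mapp g Y Z = mapp g Z Y.
Proof. by apply: smoothfun_eq => p; exact: Defs.metric_sym. Qed.

Lemma mappBl g Y Y' Z : mapp g (Y - Y') Z = mapp g Y Z - mapp g Y' Z.
Proof.
apply: smoothfun_eq => p; rewrite /= [Y p - _]addrC -scaleN1r.
by rewrite (metric_lin g) scaleN1r addrC.
Qed.

Lemma mappBr g Y Z Z' : mapp g Y (Z - Z') = mapp g Y Z - mapp g Y Z'.
Proof. by rewrite ![mapp g Y _]mapp_sym mappBl. Qed.

Lemma mapp_eq0 g Y : mapp g Y Y = 0 -> Y = 0.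
Proof.
move=> gY0; apply: vfield_eq => p; apply/eqP; apply: contraT => /(metric_gt0 g).
by rewrite (congr1 (fun h : smoothfun M => h p) gY0 : g p (Y p) (Y p) = 0) ltxx.
Qed.

Lemma smoothfun_double_eq0 (f : smoothfun M) : f + f = 0 -> f = 0.
Proof.
move=> ff0; apply: smoothfun_eq => p.
have : f p + f p = 0 by exact: (congr1 (fun h : smoothfun M => h p) ff0).
by move=> /eqP; rewrite -mulr2n mulrn_eq0 => /eqP.
Qed.

Lemma sym_antisym_eq0 g (B : V -> V -> V) :
  (forall Y Z, B Y Z = B Z Y) ->
  (forall Y Z W, mapp g (B Y Z) W = - mapp g (B Y W) Z) ->
  forall Y Z, B Y Z = 0.
Proof.
move=> Bsym Banti Y Z; apply: (@mapp_eq0 g).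
(* Three symmetric swaps alternating with three antisymmetric ones return the arguments to their
   places with sign -1; then [W] is taken to be [B Y Z] and definiteness applies. *)
have gBN W : mapp g (B Y Z) W = - mapp g (B Y Z) W.
  rewrite [in LHS](Bsym Y Z) (Banti Z Y W) (Bsym Z W) (Banti W Z Y) opprK.
  by rewrite (Bsym W Y) (Banti Y W Z).
by apply: smoothfun_double_eq0; rewrite {1}gBN addNr.
Qed.

(** [(L_X D)_Y Z] *)
Definition lie_conn X D Y Z : V :=
  bracket X (D Y Z) - D (bracket X Y) Z - D Y (bracket X Z).

Lemma torsion_free_lie_connC X D Y Z :
  torsion_free D -> lie_conn X D Y Z = lie_conn X D Z Y.
Proof.
move=> hD; have DC Y' Z' : D Y' Z' = bracket Y' Z' + D Z' Y'.
  by rewrite -hD subrK.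
rewrite /lie_conn (DC Y Z) (DC _ Z) (DC Y (bracket X Z)).
(* Jacobi cancels the three double brackets; what is left is [lie_conn X D Z Y]. *)
rewrite (derivation_overD (bracket_derivation_over X)) bracket_jacobi.
by apply: vapp_eq => h; rewrite !(vappD, vappN); ring.
Qed.

Lemma killing_lie_conn_antisym g X D Y Z W :
  killing g X -> metric_compatible g D ->
  mapp g (lie_conn X D Y Z) W = - mapp g (lie_conn X D Y W) Z.
Proof.
move=> hX hD.
have killingE Y' Z' :
    mapp g (bracket X Y') Z' = vapp X (mapp g Y' Z') - mapp g Y' (bracket X Z').
  by apply/eqP; rewrite eq_sym -subr_eq0 addrAC; apply/eqP; exact: hX.
have metricE X' Y' Z' :
    mapp g (D X' Y') Z' = vapp X' (mapp g Y' Z') - mapp g Y' (D X' Z').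
  by rewrite hD addrK.
(* With [Z] first on both sides, every operator is moved off [Z]. The second derivatives of
   [mapp g Z W] along [X] and [Y] cancel against the derivative along [bracket X Y]. *)
rewrite [in RHS]mapp_sym /lie_conn !mappBl !mappBr.
rewrite !(killingE, metricE) !(vapp_fB, vapp_bracket).
by ring.
Qed.

Lemma killing_lie_conn_eq0 g X D Y Z :
  killing g X -> levi_civita g D -> lie_conn X D Y Z = 0.
Proof.
move=> hX [torD metD]; apply: (@sym_antisym_eq0 g (lie_conn X D)) => [A B|A B C].
  exact: torsion_free_lie_connC.
exact: killing_lie_conn_antisym.
Qed.

(** * Lie derivative and covariant derivative of tensors *)

Lemma torsion_free_lie_deriv X D k (Q : tensor k) : torsion_free D ->
  lie_deriv X Q = interior_prod X (nabla D Q) + endo_act (endoA D X) Q.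
Proof.
move=> hD; apply: tensor_eq => Ys Z.
change (deriv_ext_fun (bracket X) Q Ys Z =
  deriv_ext_fun (D (vcons X Ys ord0)) Q (vtail (vcons X Ys)) Z
  + deriv_ext_fun (endoA D X) Q Ys Z).
by rewrite vcons0 vconsK; apply: deriv_ext_funD => Y; rewrite -hD.
Qed.

(** With [Y] in the differentiation slot, the claim is that the commutator of the Lie derivative
    along [X] with [D Y] is [D (bracket X Y)] on tensors; [bracketDE] is this on vector fields. *)
Lemma lie_deriv_nabla X D k (Q : tensor k) :
  (forall Y Z, lie_conn X D Y Z = 0) ->
  lie_deriv X (nabla D Q) = nabla D (lie_deriv X Q).
Proof.
move=> LD0; apply: tensor_eq => Ys Z; set Y := Ys ord0.
have bracketDE T : bracket X (D Y T) = D (bracket X Y) T + D Y (bracket X T).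
  by apply/eqP; rewrite -subr_eq0 opprD addrA; apply/eqP; exact: LD0.
change (bracket X (deriv_ext_fun (D Y) Q (vtail Ys) Z)
    - deriv_ext_fun (D Y) Q (vtail Ys) (bracket X Z)
    - \sum_(i < k.+1) deriv_ext_fun (D (upd Ys i (bracket X (Ys i)) ord0)) Q
        (vtail (upd Ys i (bracket X (Ys i)))) Z =
  deriv_ext_fun (D Y) (deriv_ext_fun (bracket X) Q) (vtail Ys) Z).
have slotE (i : 'I_k) : deriv_ext_fun
      (D (upd Ys (lift ord0 i) (bracket X (Ys (lift ord0 i))) ord0)) Q
      (vtail (upd Ys (lift ord0 i) (bracket X (Ys (lift ord0 i))))) Z =
    deriv_ext_fun (D Y) Q (upd (vtail Ys) i (bracket X (vtail Ys i))) Z.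
  by rewrite upd_other // vtail_upd.
(* Slot 0 contributes the derivative along [bracket X Y]; the remaining slots make up the Lie
   derivative of the covariant derivative along the fixed field [Y]. *)
rewrite big_ord_recl upd_same vtail_upd0 (eq_bigr _ (fun i _ => slotE i)).
have subE (a b c d : V) : a - c = b + d -> a - (b + c) = d.
  by rewrite opprD addrCA => ->; rewrite addKr.
apply: subE; exact: (deriv_ext_fun_comm (bracket_derivation_over X)
  (conn_leibniz D Y) bracketDE).
Qed.

Lemma killing_lie_deriv_iter_nabla g X D (S : tensor 0) k :
  killing g X -> levi_civita g D ->
  iter_nabla D (lie_deriv X S) k = lie_deriv X (iter_nabla D S k).
Proof.
move=> hX hD; elim: k => //= k ->; rewrite lie_deriv_nabla // => Y Z.
exact: killing_lie_conn_eq0 hX hD.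
Qed.

End LieDerivative.

Theorem lemma3p3 (R : realType) (n : nat) (M : manifold R n)
    (J : almost_complex M) (g : riemannian_metric M) (hJg : almost_hermitian J g)
    (D : connection M) (hD : levi_civita g D)
    (X : vfield M) (hX : killing g X) (k : nat) :
  iter_nabla D (lie_deriv X (acs_tensor J)) k =
  interior_prod X (iter_nabla D (acs_tensor J) k.+1)
    + endo_act (endoA D X) (iter_nabla D (acs_tensor J) k).
Proof.
rewrite (killing_lie_deriv_iter_nabla _ _ _ _ _ hX hD).
(* At [k.+1], [iter_nabla] unfolds to one [nabla] of the k-th derivative. *)
by apply: torsion_free_lie_deriv; case: hD.
Qed.
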